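(* Let $d\geq3$ be an integer, let $P$ be a homogeneous geometric lattice of rank $d$, and let $X$ be the order complex of $\bar P=P\setminus\{\hat0,\hat1\}$ with the uniform distribution on maximal faces. Let $\Gamma$ be any group (possibly non-abelian). Then $H^1(X,\Gamma)=0$ (i.e. $Z^1(X,\Gamma)=B^1(X,\Gamma)$) and $h^1(X,\Gamma)\geq\frac{1}{198288}$.
   Context: A geometric lattice is a finite lattice with $\hat0,\hat1$ and rank function $\mathrm{rk}$ satisfying $\mathrm{rk}(x)+\mathrm{rk}(y)\ge\mathrm{rk}(x\vee y)+\mathrm{rk}(x\wedge y)$ in which every element is a join of rank-1 elements; it is homogeneous if $\mathrm{Aut}(P)$ acts transitively on maximal chains of $\bar P$. The order complex has chains as faces. Cochains: $C^0(X,\Gamma)$ = functions on vertices, $C^1(X,\Gamma)$ = functions $f$ on ordered edges with $f(vu)=f(uv)^{-1}$, $C^2$ similarly antisymmetric on ordered triangles; $\delta_0h(vu)=h(v)h(u)^{-1}$, $\delta_1f(vuw)=f(vu)f(uw)f(wv)$. $\mathrm{wt}(f)=\Pr[f\neq e]$, $\mathrm{dist}(f,g)=\Pr[f\neq g]$ under the distributions on edges/triangles induced from the uniform distribution on maximal faces; $B^1=\mathrm{Im}\,\delta_0$, $Z^1=\ker\delta_1=\{f:\delta_1f\equiv e\}$; $h^1(X,\Gamma)=\min_{f\in C^1\setminus B^1}\mathrm{wt}(\delta_1f)/\mathrm{dist}(f,B^1)$.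
   Formalization: With rank d meaning rk(1̂)=d, X is assumed to contain a triangle, which excludes exactly d=3: there X is a graph, wt(δ₁f) is undefined and Z¹=B¹ fails (Boolean lattice of rank 3: hexagon, Γ=Z/2). For d≥4 the assumption is automatic. *)

(* Defs.v *)
From HB Require Import structures.
From mathcomp Require Import all_boot all_order all_algebra all_fingroup.
From mathcomp Require Import boolp classical_sets reals constructive_ereal ereal.
Set Implicit Arguments.
Unset Strict Implicit.
Unset Printing Implicit Defensive.
Import Order.TTheory GRing.Theory Num.Theory.

Section Lattice.
Context {disp : Order.disp_t} (P : finTBLatticeType disp).
Local Open Scope order_scope.

Definition covers (x y : P) : Prop :=
  x < y /\ forall z : P, ~~ ((x < z) && (z < y)).

Definition rank_function (rk : P -> nat) : Prop :=
  rk \bot = 0%N /\ forall x y : P, covers x y -> rk y = (rk x).+1.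

Definition geometric_lattice (rk : P -> nat) : Prop :=
  [/\ rank_function rk,
      forall x y : P, (rk (x `|` y) + rk (x `&` y) <= rk x + rk y)%N &
      forall x : P, exists2 A : {set P},
        (forall a, a \in A -> rk a = 1%N) & x = \join_(a in A) a].

Definition is_chain (s : {set P}) : bool :=
  [forall x in s, forall y in s, (x <= y) || (y <= x)].

(* The faces (the empty one included) of the order complex of P minus
   {\bot, \top}. *)
Definition order_complex : {set {set P}} :=
  [set s : {set P} | is_chain s & (\bot \notin s) && (\top \notin s)]%SET.

End Lattice.

(* A simplicial complex on V is given by its set of faces X : {set {set V}}. *)
Section Complex.
Context {V : finType} (X : {set {set V}}).

Definition maximal_faces : {set {set V}} :=
  [set s | maxset (fun t => t \in X) s]%SET.

Definition edge (v u : V) : bool :=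
  uniq [:: v; u] && ([set v; u]%SET \in X).

Definition triangle (v u w : V) : bool :=
  uniq [:: v; u; w] && ([set v; u; w]%SET \in X).

(* The distribution on triangles, hence wt of a 2-cochain and h^1, exists only
   when this holds.  The order complex of a rank-3 lattice is a graph and fails
   it; Z^1 is then all of C^1: e.g. for the Boolean lattice of rank 3 the
   complex is a hexagon, and Z^1 <> B^1 as soon as the group is nontrivial. *)
Definition has_triangle : Prop := exists v u w, triangle v u w.

(* Probability that t is obtained by choosing a maximal face s uniformly and
   then, uniformly, an ordered (size t)-tuple of distinct vertices of s; there
   are #|s| ^_ (size t) such tuples.  Cochains being antisymmetric, ordered and
   unordered faces give the same probability to the events used below. *)
Definition mass (R : realType) (t : seq V) : R :=
  (\sum_(s in maximal_faces | uniq t && all (fun x => x \in s) t)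
     (#|maximal_faces|%:R^-1 * (#|s| ^_ (size t))%:R^-1))%R.

(* Cochains are encoded by total functions; only the values at vertices,
   ordered edges and ordered triangles of X matter, and C1, B1 and Z1 are
   stable under changing the other values. *)
Section Cochains.
Context {G : groupType}.

Definition delta0 (h : V -> G) (v u : V) : G := (h v * (h u)^-1)%g.

Definition delta1 (f : V -> V -> G) (v u w : V) : G :=
  (f v u * f u w * f w v)%g.

Definition C1 : set (V -> V -> G) :=
  fun f => forall v u, edge v u -> f v u = ((f u v)^-1)%g.

Definition B1 : set (V -> V -> G) :=
  fun f => exists h : V -> G, forall v u, edge v u -> f v u = delta0 h v u.

Definition Z1 : set (V -> V -> G) :=
  fun f => C1 f /\ forall v u w, triangle v u w -> delta1 f v u w = 1%g.

Definition dist1 (R : realType) (f g : V -> V -> G) : R :=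
  (\sum_(v : V) \sum_(u : V | f v u != g v u) mass R [:: v; u])%R.

Definition wt2 (R : realType) (f : V -> V -> V -> G) : R :=
  (\sum_(v : V) \sum_(u : V) \sum_(w : V | f v u w != 1%g)
     mass R [:: v; u; w])%R.

Definition dist_B1 (R : realType) (f : V -> V -> G) : R :=
  inf (dist1 R f @` B1)%classic.

End Cochains.

(* Extended-real valued, so that the minimum over the empty set (when
   C1 = B1) is +oo. *)
Definition h1 (R : realType) (G : groupType) : \bar R :=
  ereal_inf ((fun f : V -> V -> G => (wt2 R (delta1 f) / dist_B1 R f)%:E%R)
               @` (C1 `\` B1))%classic.

End Complex.

Section Homogeneous.
Context {disp : Order.disp_t} (P : finTBLatticeType disp).

Definition lattice_automorphism (g : {perm P}) : Prop :=
  forall x y : P, (g x <= g y)%O = (x <= y)%O.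

Definition homogeneous : Prop :=
  forall s t : {set P},
    s \in maximal_faces (order_complex P) ->
    t \in maximal_faces (order_complex P) ->
    exists2 g : {perm P}, lattice_automorphism g & t = (g @: s)%SET.

End Homogeneous.

(* Main.v *)
(* A 1-cochain [f] is trivialised by a cone: a base vertex c and, for each vertex x,
   a path from x to c; the cochain H x multiplies the values of [f] along this path.
   An edge on which [f] differs from [delta0 H] forces a violated triangle in any
   filling of the loop made of the edge and of the two paths.  Translating the cone by
   a random automorphism makes each triangle of a filling uniform among those of its
   ranks, by homogeneity, so the expected distance is a sum of violation
   probabilities of rank triples, one for each triangle used.

   For the result not to depend on d, the rank triples used must be spread out.
   Elements of low rank have joins whose rank is controlled by submodularity, so the
   cone is built there, with path ranks a, b, k, s that vary in windows of length
   proportional to d, and it is extended to the elements of high rank by descending to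
   an element of rank a.  Averaging over the windows gives a cheap choice.  For small
   d a cone over an atom, with crude bounds, suffices. *)
Require Import Defs.
From mathcomp Require Import all_boot all_order all_algebra all_fingroup.
From mathcomp Require Import boolp classical_sets reals constructive_ereal ereal.
From mathcomp Require Import zify.
Set Implicit Arguments.
Unset Strict Implicit.
Unset Printing Implicit Defensive.

(** * Rank functions and automorphisms *)

Section RankedLattice.
Import Order.TTheory.
Local Open Scope order_scope.
Context {disp : Order.disp_t} {P : finTBLatticeType disp} {rk : P -> nat}.
Hypothesis hrk : rank_function rk.

Lemma exists_cover (x y : P) : x < y -> exists2 z, covers x z & z <= y.
Proof.
move=> xy.
have Py : (x < y) && (y <= y) by rewrite xy lexx.
case: (@arg_minnP P y (fun z => (x < z) && (z <= y))
  (fun z => #|[set t : P | t <= z]%SET|) Py) => z /andP[xz zy] zmin.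
exists z => //; split=> // t; apply/negP => /andP[xt tz].
have := zmin t; rewrite xt (le_trans (ltW tz) zy) => /(_ isT).
rewrite leqNgt => /negP; apply; apply: proper_card; apply/properP; split.
  by apply/fintype.subsetP => u; rewrite !inE => /le_trans; apply; exact: ltW.
by exists z; rewrite !inE ?lexx // lt_geF.
Qed.

(** The rank is prescribed on covers only; climbing along covers, by induction on the number of
    elements above [x], reaches any larger [y]. *)
Lemma rank_lt (x y : P) : x < y -> (rk x < rk y)%N.
Proof.
have [m] := ubnP #|[set t : P | x < t]%SET|.
elim: m x => // m IH x; rewrite ltnS => xm xy.
have [z xz zy] := exists_cover xy; have rz := hrk.2 _ _ xz.
have [<-|zny] := eqVneq z y; first by rewrite rz.
apply: (@ltn_trans (rk z)); first by rewrite rz.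
apply: IH; last by rewrite lt_neqAle zny.
apply: leq_trans xm; apply: proper_card; apply/properP; split.
  by apply/fintype.subsetP => u; rewrite !inE; apply: lt_trans; exact: xz.1.
by exists z; rewrite !inE ?ltxx //; exact: xz.1.
Qed.

Lemma rank_le (x y : P) : x <= y -> (rk x <= rk y)%N.
Proof. by rewrite le_eqVlt => /predU1P[->//|/rank_lt/ltnW]. Qed.

Lemma rank_between (x y : P) (k : nat) : x <= y -> (rk x <= k <= rk y)%N ->
  exists z, [/\ x <= z, z <= y & rk z = k].
Proof.
move=> xy /andP[]; move: {2}(k - rk x)%N (erefl (k - rk x)%N) => m.
elim: m x xy => [|m IH] x xy xk_m xk ky.
  by exists x; split=> //; apply/eqP; rewrite eqn_leq xk /=; lia.
have xlty : x < y.
  by rewrite lt_neqAle xy andbT; apply/eqP => e; rewrite e in xk_m; lia.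
have [z xz zy] := exists_cover xlty; have rz := hrk.2 _ _ xz.
have [||//|w [zw wy rw]] := IH z zy; try lia.
by exists w; split=> //; apply: le_trans zw; exact: ltW xz.1.
Qed.

Lemma rank_gt0 (x : P) : (0 < rk x)%N = (x != \bot).
Proof.
have [->|xn] := eqVneq x \bot; first by rewrite hrk.1.
have bx : \bot < x by rewrite lt0x.
exact: leq_ltn_trans (leq0n _) (rank_lt bx).
Qed.

Lemma rank_lt_top (x : P) : (rk x < rk \top)%N = (x != \top).
Proof.
have [->|xn] := eqVneq x \top; first by rewrite ltnn.
by apply: rank_lt; rewrite ltx1.
Qed.

(** An element of positive rank covers one of the rank just below, and automorphisms preserve
    covers, so induction on the rank applies. *)
Lemma automorphism_rank (g : {perm P}) (x : P) :
  lattice_automorphism g -> rk (g x) = rk x.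
Proof.
move=> gaut.
have glt u v : (g u < g v) = (u < v) by rewrite !lt_neqAle gaut (inj_eq perm_inj).
move: {2}(rk x) (erefl (rk x)) => m; elim: m x => [|m IH] x xm.
  have -> : x = \bot by apply/eqP; rewrite -[_ == _]negbK -rank_gt0 xm.
  have : g \bot <= g (g^-1%g \bot) by rewrite gaut le0x.
  by rewrite permKV lex0 => /eqP ->.
have [||y [_ yx rky]] := @rank_between \bot x m; first exact: le0x.
  by rewrite hrk.1 xm /=.
have xy : y < x.
  by rewrite lt_neqAle yx andbT; apply/eqP => e; move: xm; rewrite -e rky; lia.
have cg : covers (g y) (g x).
  split=> [|z]; first by rewrite glt.
  rewrite -[z](permKV g) !glt; apply/negP => /andP[/rank_lt + /rank_lt].
  by rewrite rky xm; lia.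
by rewrite (hrk.2 _ _ cg) IH // rky xm.
Qed.

End RankedLattice.

(** * Flags, that is maximal chains, indexed by rank *)

Section Flags.
Import Order.TTheory.
Local Open Scope order_scope.
Context {disp : Order.disp_t} {P : finTBLatticeType disp} {rk : P -> nat}.
Hypothesis hrk : rank_function rk.
Variable n : nat.
Hypothesis hn : rk \top = n.+1.

Definition flags : {set {set P}} := maximal_faces (order_complex P).

Lemma flag_face (F : {set P}) : F \in flags -> F \in order_complex P.
Proof. by rewrite inE => /maxsetP[]. Qed.

Lemma face_extends (s : {set P}) : s \in order_complex P ->
  exists2 F, F \in flags & s \subset F.
Proof.
move=> sX; have [F Fmax sF] := @maxset_exists _ (fun t => t \in order_complex P) s sX.
by exists F => //; rewrite inE.
Qed.

Lemma face_chain (s : {set P}) (x y : P) : s \in order_complex P ->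
  x \in s -> y \in s -> (x <= y) || (y <= x).
Proof.
by rewrite inE => /andP[/'forall_implyP h _] /h /'forall_implyP; apply.
Qed.

Lemma face_rank (s : {set P}) (x : P) : s \in order_complex P ->
  x \in s -> (0 < rk x <= n)%N.
Proof.
rewrite inE => /andP[_ /andP[s0 s1]] xs.
rewrite (rank_gt0 hrk) -ltnS -hn (rank_lt_top hrk).
by apply/andP; split; [apply: contraNneq s0 | apply: contraNneq s1] => <-.
Qed.

Lemma face_le (s : {set P}) (x y : P) : s \in order_complex P ->
  x \in s -> y \in s -> (x <= y) = (rk x <= rk y)%N.
Proof.
move=> sX xs ys; apply/idP/idP; first exact: rank_le.
case/orP: (face_chain sX xs ys) => // yx xy.
have [->//|ne] := eqVneq y x.
have : (rk y < rk x)%N by apply: (rank_lt hrk); rewrite lt_neqAle ne.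
by rewrite ltnNge xy.
Qed.

Lemma face_rank_inj (s : {set P}) (x y : P) : s \in order_complex P ->
  x \in s -> y \in s -> rk x = rk y -> x = y.
Proof.
by move=> sX xs ys e; apply/le_anti; rewrite !(face_le sX) // e leqnn.
Qed.

Lemma chainP (s : {set P}) :
  reflect ((forall x, x \in s -> (0 < rk x <= n)%N) /\
           (forall x y, x \in s -> y \in s -> (x <= y) || (y <= x)))
    (s \in order_complex P).
Proof.
apply: (iffP idP) => [sX|[hr hc]].
  by split=> [x|x y]; [exact: face_rank | exact: face_chain].
rewrite inE; apply/andP; split.
  apply/'forall_implyP => x xs; apply/'forall_implyP => y ys; exact: hc.
apply/andP; split; apply/negP => /hr; first by rewrite hrk.1.
by rewrite hn ltnn andbF.
Qed.

(** If rank [i] were missing, an element of rank [i] could be inserted between the neighbours of the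
    gap, against maximality. *)
Lemma flag_has_rank (F : {set P}) (i : nat) : F \in flags -> (0 < i <= n)%N ->
  exists2 x, x \in F & rk x = i.
Proof.
move=> FF /andP[i0 i_n]; have FX := flag_face FF.
have [/existsP[x /andP[xF /eqP]]|no] := boolP [exists x, (x \in F) && (rk x == i)].
  by exists x.
have noi x : x \in F -> rk x != i.
  by move=> xF; apply: contraNneq no => e; apply/existsP; exists x; rewrite xF e eqxx.
(* Adding [\bot] here and [\top] below ensures that the gap at rank [i] has a neighbour on each
   side. *)
have Px : (\bot \in \bot |: F)%SET && (rk \bot < i)%N by rewrite !inE eqxx hrk.1.
case: (@arg_maxnP P \bot (fun z => (z \in \bot |: F)%SET && (rk z < i)%N) rk Px)
  => x /andP[xF xi] xmax.
have Py : (\top \in \top |: F)%SET && (i < rk \top)%N by rewrite !inE eqxx hn.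
case: (@arg_minnP P \top (fun z => (z \in \top |: F)%SET && (i < rk z)%N) rk Py)
  => y /andP[yF yi] ymin.
have xy : x <= y.
  move: xF yF; rewrite !inE => /predU1P[->|xF]; first by rewrite le0x.
  move=> /predU1P[->|yF]; first by rewrite lex1.
  by rewrite (face_le FX) // ltnW // (ltn_trans xi).
have [|z [xz zy rz]] := rank_between hrk xy (k := i); first by rewrite (ltnW xi) (ltnW yi).
have zcmp t : t \in F -> (t <= z) || (z <= t).
  move=> tF; have := noi t tF; rewrite neq_ltn => /orP[ti|it].
    have := xmax t; rewrite in_setU1 tF orbT ti => /(_ isT) tx.
    apply/orP; left; apply: le_trans xz; move: xF; rewrite in_setU1 => /predU1P[xb|xF].
      move: tx; rewrite xb /= hrk.1 leqn0 => /eqP rt.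
      by have := face_rank FX tF; rewrite rt.
    by rewrite (face_le FX).
  have := ymin t; rewrite in_setU1 tF orbT it => /(_ isT) ty.
  apply/orP; right; apply: le_trans zy _; move: yF; rewrite in_setU1 => /predU1P[yb|yF].
    move: ty; rewrite yb hn => rt.
    by have /andP[_] := face_rank FX tF; rewrite leqNgt rt.
  by rewrite (face_le FX).
have zFX : (z |: F)%SET \in order_complex P.
  apply/chainP; split=> [u|u v]; rewrite !in_setU1.
    by case/predU1P=> [->|/(face_rank FX)//]; rewrite rz i0 i_n.
  case/predU1P=> [->|uF]; case/predU1P=> [->|vF]; rewrite ?lexx //.
  - by rewrite orbC zcmp.
  - exact: zcmp.
  - exact: face_chain FX uF vF.
move: FF; rewrite inE => /maxsetP[_ Fmax].
exists z => //; rewrite -(Fmax _ zFX) ?setU11 //; exact: subsetU1.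
Qed.

(* The element of rank [i] of the flag [F]; [\bot] when there is none. *)
Definition elt (F : {set P}) (i : nat) : P :=
  odflt \bot [pick x in F | rk x == i].

Lemma elt_in (F : {set P}) (i : nat) : F \in flags -> (0 < i <= n)%N ->
  elt F i \in F /\ rk (elt F i) = i.
Proof.
move=> FF hi; rewrite /elt; case: pickP => [x /andP[xF /eqP//]|none] /=.
have [x xF xi] := flag_has_rank FF hi.
by have := none x; rewrite xF xi eqxx.
Qed.

Lemma elt_rank (F : {set P}) (x : P) : F \in flags -> x \in F -> elt F (rk x) = x.
Proof.
move=> FF xF; have FX := flag_face FF.
have [eF re] := elt_in FF (face_rank FX xF).
exact: face_rank_inj FX eF xF re.
Qed.

(** The rank is a bijection from a flag onto 1, ..., [n], so sums over flags become sums over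
    ranks. *)
Lemma big_flag (T : Type) (idx : T) (op : Monoid.com_law idx) (F : {set P})
    (phi : P -> T) : F \in flags ->
  \big[op/idx]_(x in F) phi x = \big[op/idx]_(1 <= i < n.+1) phi (elt F i).
Proof.
move=> FF; rewrite -big_enum.
have pm : perm_eq (enum F) [seq elt F i | i <- index_iota 1 n.+1].
  apply: uniq_perm; first exact: enum_uniq.
    rewrite map_inj_in_uniq ?iota_uniq // => i j.
    rewrite !mem_index_iota !ltnS => hi hj e.
    by rewrite -(elt_in FF hi).2 e (elt_in FF hj).2.
  move=> x; rewrite mem_enum; apply/idP/mapP => [xF|[i]].
    exists (rk x); last by rewrite elt_rank.
    by rewrite mem_index_iota ltnS (face_rank (flag_face FF)).
  by rewrite mem_index_iota ltnS => hi ->; exact: (elt_in FF hi).1.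
by rewrite (perm_big _ pm) big_map.
Qed.

Lemma card_flag (F : {set P}) : F \in flags -> #|F| = n.
Proof. by move=> FF; rewrite -sum1_card (big_flag _ _ FF) sum_nat_const_nat muln1 subn1. Qed.

End Flags.

(** * The action of automorphisms on flags *)

Section Automorphisms.
Import Order.TTheory.
Local Open Scope order_scope.
Context {disp : Order.disp_t} {P : finTBLatticeType disp} {rk : P -> nat}.
Hypothesis hrk : rank_function rk.
Variable n : nat.
Hypothesis hn : rk \top = n.+1.

Definition auts : {set {perm P}} :=
  [set g : {perm P} | [forall x, forall y, (g x <= g y) == (x <= y)]]%SET.

Lemma autP (g : {perm P}) : reflect (lattice_automorphism g) (g \in auts).
Proof.
rewrite inE; apply: (iffP idP) => [/'forall_'forall_eqP h x y|h]; first exact: h.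
by apply/'forall_'forall_eqP => x y; exact: h.
Qed.

Lemma flag_of_card (s : {set P}) : s \in order_complex P -> #|s| = n -> s \in flags.
Proof.
move=> sX sn; have [F FF sF] := face_extends sX.
suff -> : s = F by [].
by apply/eqP; rewrite eqEcard sF (card_flag hrk hn FF) sn leqnn.
Qed.

Lemma automorphism_flag (g : {perm P}) (F : {set P}) :
  g \in auts -> F \in flags -> (g @: F)%SET \in flags.
Proof.
move=> /autP ga FF; have FX := flag_face FF.
apply: flag_of_card; last by rewrite card_imset ?(card_flag hrk hn FF) //; exact: perm_inj.
apply/(chainP hrk hn); split=> [_ /imsetP[x xF ->]|_ _ /imsetP[x xF ->] /imsetP[y yF ->]].
  by rewrite (automorphism_rank hrk) // (face_rank hrk hn FX).
by rewrite !ga; exact: face_chain FX xF yF.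
Qed.

Lemma automorphism_elt (g : {perm P}) (F : {set P}) (x : P) :
  g \in auts -> F \in flags -> x \in F -> elt (rk := rk) (g @: F)%SET (rk x) = g x.
Proof.
move=> ga FF xF; rewrite -(automorphism_rank hrk x (elimT (autP g) ga)).
apply: (elt_rank hrk hn) (automorphism_flag ga FF) _; exact: imset_f.
Qed.

Hypothesis hhom : homogeneous P.

(** Homogeneity gives [h] carrying [F0] to [F]; multiplication by [h] maps the stabiliser of [F0]
    bijectively onto the transporter. *)
Lemma card_transporter (F0 F : {set P}) : F0 \in flags -> F \in flags ->
  #|[set g in auts | g @: F0 == F]%SET| = #|[set g in auts | g @: F0 == F0]%SET|.
Proof.
move=> F0F FF; have [h hA hF] := hhom F0F FF.
have hK : (h^-1%g @: F = F0)%SET.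
  by rewrite hF -imset_comp -[RHS]imset_id; apply: eq_imset => x /=; rewrite permK.
rewrite -[RHS](card_imset _ (mulIg h)); apply: eq_card => g; rewrite inE.
apply/idP/imsetP => [/andP[/autP ga /eqP gF]|[k]].
  exists (g * h^-1)%g; last by rewrite mulgKV.
  rewrite inE; apply/andP; split.
    by apply/autP => x y; rewrite !permM -[LHS]hA !permKV ga.
  apply/eqP; rewrite -[RHS]hK -gF -imset_comp; apply: eq_imset => x /=.
  by rewrite permM.
rewrite inE => /andP[/autP ka /eqP kF] ->; apply/andP; split.
  by apply/autP => x y; rewrite !permM hA ka.
apply/eqP; rewrite hF -[in RHS]kF -imset_comp; apply: eq_imset => x /=.
by rewrite permM.
Qed.

(* A uniformly random automorphism moves a fixed flag to a uniformly random flag. *)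
Lemma sum_automorphism_flag (F0 : {set P}) (phi : {set P} -> nat) : F0 \in flags ->
  ((\sum_(g in auts) phi (g @: F0)%SET) * #|@flags _ P| =
   #|auts| * \sum_(F in @flags _ P) phi F)%N.
Proof.
move=> F0F; set k := #|[set g in auts | g @: F0 == F0]%SET|.
have E psi : (\sum_(g in auts) psi (g @: F0)%SET =
    k * \sum_(F in @flags _ P) psi F)%N.
  rewrite (partition_big (fun g : {perm P} => (g @: F0)%SET) (mem flags)) /=; last first.
    by move=> g ga; exact: automorphism_flag.
  rewrite big_distrr /=; apply: eq_bigr => F FF.
  rewrite (eq_bigr (fun=> psi F)) => [|g /andP[_ /eqP -> //]].
  rewrite sum_nat_const /k -(card_transporter F0F FF); congr (_ * _)%N.
  by apply: eq_card => g; rewrite [RHS]inE.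
have := E (fun=> 1%N); rewrite !sum1_card E => ->; lia.
Qed.

Lemma chain3_face (x y z : P) :
  (0 < rk x <= n)%N -> (0 < rk y <= n)%N -> (0 < rk z <= n)%N ->
  x >=< y -> y >=< z -> x >=< z -> [set x; y; z]%SET \in order_complex P.
Proof.
move=> rx ry rz xy yz xz; apply/(chainP hrk hn); split=> [u|u v].
  by rewrite !inE => /orP[/orP[]|] /eqP ->.
by rewrite !inE => /orP[/orP[]|] /eqP -> /orP[/orP[]|] /eqP ->;
  rewrite ?lexx // ?[_ || _]comparable_sym // orbC.
Qed.

Lemma chain_has_rank (x y : P) (a : nat) : (0 < a <= n)%N ->
  (0 < rk x <= n)%N -> (0 < rk y <= n)%N -> x >=< y ->
  exists z, [/\ rk z = a, x >=< z & y >=< z].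
Proof.
move=> an rx ry xy.
have [F FF /fintype.subsetP sF] :=
  face_extends (chain3_face rx ry ry xy (comparablexx y) xy).
have [z zF rz] := flag_has_rank hrk hn FF an; have FX := flag_face FF.
by exists z; split=> //; apply: (face_chain FX) => //; apply: sF; rewrite !inE eqxx ?orbT.
Qed.

Variable tri : P -> P -> P -> bool.

Definition tricount (i j k : nat) : nat :=
  (\sum_(F in @flags _ P)
     tri (elt (rk := rk) F i) (elt (rk := rk) F j) (elt (rk := rk) F k))%N.

(** The three elements extend to a flag, in which they are determined by their ranks; a random
    automorphism makes this flag uniform. *)
Lemma sum_automorphism_tri (x y z : P) :
  (0 < rk x <= n)%N -> (0 < rk y <= n)%N -> (0 < rk z <= n)%N ->
  x >=< y -> y >=< z -> x >=< z ->
  ((\sum_(g in auts) tri (g x) (g y) (g z)) * #|@flags _ P| =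
   #|auts| * tricount (rk x) (rk y) (rk z))%N.
Proof.
move=> rx ry rz xy yz xz.
have [F FF /fintype.subsetP sF] := face_extends (chain3_face rx ry rz xy yz xz).
have [xF yF zF] : [/\ x \in F, y \in F & z \in F].
  by split; apply: sF; rewrite !inE eqxx ?orbT.
rewrite -(sum_automorphism_flag (fun F : {set P} => tri (elt (rk := rk) F (rk x))
  (elt (rk := rk) F (rk y)) (elt (rk := rk) F (rk z)) : nat) FF).
congr (_ * _)%N; apply: eq_bigr => g ga.
by rewrite !(automorphism_elt ga FF).
Qed.

End Automorphisms.

(** * Filling loops with triangles *)

Section Fillings.
Local Open Scope group_scope.
Context {V : Type} {G : groupType} (F : V -> V -> G) (h : V -> G).
Hypothesis Fsym : forall x y, F y x = (F x y)^-1.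

Definition bad_triangle (x y z : V) : bool := F x y * F y z * F z x != 1.

Definition bad_edge (x y : V) : bool := F x y != h x * (h y)^-1.

Lemma good_triangle (x y z : V) : ~~ bad_triangle x y z -> F x z = F x y * F y z.
Proof. by rewrite negbK (Fsym x z) => /eqP/(canRL (mulgK _)); rewrite mul1g invgK => ->. Qed.

Lemma bad_edge_triangle (x y z : V) :
  (bad_edge x y <= bad_triangle x y z + bad_edge x z + bad_edge y z)%N.
Proof.
have [_|/good_triangle exz] := boolP (bad_triangle x y z); first lia.
have [_|/negbNE/eqP hxz] := boolP (bad_edge x z); first lia.
have [_|/negbNE/eqP hyz] := boolP (bad_edge y z); first lia.
suff /eqP exy : F x y = h x * (h y)^-1 by rewrite /bad_edge exy.
have -> : F x y = F x z * (F y z)^-1 by rewrite exz mulgK.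
by rewrite hxz hyz invMg invgK mulgA mulgKV.
Qed.

(** The pentagon x, z, z', c, x' is coned from [w]. If its five triangles are good, then
    [F x w = h x * F c w] and [F z w = h z * F c w], and [F c w] cancels. *)
Lemma bad_edge_cone (x z x' z' c w : V) :
  h x = F x x' * F x' c -> h z = F z z' * F z' c ->
  (bad_edge x z <= bad_triangle x x' w + bad_triangle x z w + bad_triangle z z' w +
                   bad_triangle c x' w + bad_triangle c z' w)%N.
Proof.
move=> hx hz.
have [_|/good_triangle exw] := boolP (bad_triangle x x' w); first lia.
have [_|/good_triangle exzw] := boolP (bad_triangle x z w); first lia.
have [_|/good_triangle ezw] := boolP (bad_triangle z z' w); first lia.
have [_|/good_triangle ecx] := boolP (bad_triangle c x' w); first lia.
have [_|/good_triangle ecz] := boolP (bad_triangle c z' w); first lia.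
suff /eqP exz : F x z = h x * (h z)^-1 by rewrite /bad_edge exz.
have -> : F x z = F x w * (F z w)^-1 by rewrite exzw mulgK.
have fx : F x w = h x * F c w.
  by rewrite exw hx ecx (Fsym c x') !mulgA -[_ * (F c x')^-1 * _]mulgA mulVg mulg1.
have fz : F z w = h z * F c w.
  by rewrite ezw hz ecz (Fsym c z') !mulgA -[_ * (F c z')^-1 * _]mulgA mulVg mulg1.
by rewrite fx fz invMg mulgA mulgK.
Qed.

(** Two triangles with apex [w] trade the edge from [y] to [z] for two edges at [w], which can be
    taken of lower rank than [y]. *)
Lemma bad_edge_descent (y y' z w : V) : h y = F y y' * h y' ->
  (bad_edge y z <= bad_triangle y y' w + bad_triangle y z w +
                   bad_edge w y' + bad_edge w z)%N.
Proof.
move=> hy.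
have [_|/good_triangle eyw] := boolP (bad_triangle y y' w); first lia.
have [_|/good_triangle ezw] := boolP (bad_triangle y z w); first lia.
have [_|/negbNE/eqP hwy] := boolP (bad_edge w y'); first lia.
have [_|/negbNE/eqP hwz] := boolP (bad_edge w z); first lia.
suff /eqP eyz : F y z = h y * (h z)^-1 by rewrite /bad_edge eyz.
have -> : F y z = F y w * (F z w)^-1 by rewrite ezw mulgK.
rewrite -Fsym eyw hwz (Fsym w y') hwy hy invMg invgK.
by rewrite !mulgA mulgKV.
Qed.

End Fillings.

(** * Random cones and the expected cost of an edge *)

Section Cone.
Import Order.TTheory.
Local Open Scope order_scope.
Context {disp : Order.disp_t} {P : finTBLatticeType disp} {rk : P -> nat}.
Hypothesis hrk : rank_function rk.
Hypothesis rk_submod :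
  forall x y : P, (rk (x `|` y) + rk (x `&` y) <= rk x + rk y)%N.
Variable n : nat.
Hypothesis hn : rk \top = n.+1.
Hypothesis hhom : homogeneous P.
Context {G : groupType} (F : P -> P -> G).
Hypothesis Fsym : forall x y, F y x = ((F x y)^-1)%g.

Let proper x := (0 < rk x <= n)%N.
(** The cone stays fixed and the cochain is translated, instead of the converse. *)
Let Fg (g : {perm P}) x y := F (g x) (g y).
Let e := tricount (rk := rk) (bad_triangle F).

Lemma sum_bad_triangle (x y z : P) : proper x -> proper y -> proper z ->
  x >=< y -> y >=< z -> x >=< z ->
  ((\sum_(g in @auts _ P) bad_triangle (Fg g) x y z) * #|@flags _ P| =
   #|@auts _ P| * e (rk x) (rk y) (rk z))%N.
Proof. exact: (sum_automorphism_tri hrk hn hhom). Qed.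

(* [h g] multiplies the values of [F], translated by [g], along the path x, p x, c
   when x has rank at most [l], and along y, y', p y', c with y' < y of rank [a]
   otherwise.  [u i] bounds the cost of the edges between the ranks [a] and [i]; an
   arbitrary edge forms a triangle with an element of rank [a]. *)
Lemma cone_bound (a b l : nat) (c : P) (p : P -> P) (u : nat -> nat) :
  (0 < a)%N -> (2 * a <= b)%N -> (b <= l)%N -> (l <= n)%N -> proper c ->
  (forall x, proper x -> (rk x <= l)%N -> x <= p x /\ c <= p x) ->
  (forall x z, proper x -> (rk x <= l)%N -> rk z = a -> x >=< z ->
     exists w, [/\ p x <= w, p z <= w, (rk w <= n)%N &
       (e (rk x) (rk (p x)) (rk w) + e (rk x) a (rk w) + e a (rk (p z)) (rk w) +
        e (rk c) (rk (p x)) (rk w) + e (rk c) (rk (p z)) (rk w) <= u (rk x))%N]) ->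
  (forall j, (l < j <= n)%N -> (2 * e j a b + 2 * u b <= u j)%N) ->
  exists h : {perm P} -> P -> G, forall x y, proper x -> proper y -> x >=< y ->
    ((\sum_(g in @auts _ P) bad_edge (Fg g) (h g) x y) * #|@flags _ P| <=
     #|@auts _ P| * (e (rk x) (rk y) a + u (rk x) + u (rk y)))%N.
Proof.
move=> a0 ab bl ln pc hp hlow hhigh.
have al : (a <= l)%N by move: ab bl; clear; lia.
(* The default is never met: [d] is applied above rank [l] only, and [a <= l] provides an element of
   rank [a] below. *)
pose d y : P := odflt \bot [pick y' | (y' <= y) && (rk y' == a)].
pose low g x := (Fg g x (p x) * Fg g (p x) c)%g.
pose h g x := if (rk x <= l)%N then low g x else (Fg g x (d x) * low g (d x))%g.
have Fgs g x y : Fg g y x = ((Fg g x y)^-1)%g by exact: Fsym.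
(* Edges from a low element to rank [a]: both ends have a direct path through [p], so the pentagon
   filling applies. *)
have lowB x z : proper x -> (rk x <= l)%N -> rk z = a -> x >=< z ->
  ((\sum_(g in @auts _ P) bad_edge (Fg g) (h g) x z) * #|@flags _ P| <=
   #|@auts _ P| * u (rk x))%N.
  move=> px xl za xz.
  have zl : (rk z <= l)%N by rewrite za.
  have pz : proper z by rewrite /proper; lia.
  have [xpx cpx] := hp _ px xl; have [zpz cpz] := hp _ pz zl.
  have [w [xw zw wn hu]] := hlow _ _ px xl za xz.
  have xw' := le_trans xpx xw; have zw' := le_trans zpz zw.
  have cw := le_trans cpx xw.
  have prop v v' : proper v -> v <= v' -> v' <= w -> proper v'.
    move=> /andP[v0 _] /(rank_le hrk) r1 /(rank_le hrk) r2.
    by rewrite /proper (leq_trans v0 r1) (leq_trans r2 wn).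
  have pw := prop _ _ px xw' (lexx _).
  have ppx := prop _ _ px xpx xw; have ppz := prop _ _ pz zpz zw.
  have T := sum_bad_triangle; have cmp := le_comparable.
  have t1 := T _ _ _ px ppx pw (cmp _ _ _ _ xpx) (cmp _ _ _ _ xw) (cmp _ _ _ _ xw').
  have t2 := T _ _ _ px pz pw xz (cmp _ _ _ _ zw') (cmp _ _ _ _ xw').
  have t3 := T _ _ _ pz ppz pw (cmp _ _ _ _ zpz) (cmp _ _ _ _ zw) (cmp _ _ _ _ zw').
  have t4 := T _ _ _ pc ppx pw (cmp _ _ _ _ cpx) (cmp _ _ _ _ xw) (cmp _ _ _ _ cw).
  have t5 := T _ _ _ pc ppz pw (cmp _ _ _ _ cpz) (cmp _ _ _ _ zw) (cmp _ _ _ _ cw).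
  rewrite za in t2 t3; apply: leq_trans (leq_mul (leqnn _) hu).
  rewrite !mulnDr -t1 -t2 -t3 -t4 -t5 -!mulnDl leq_mul2r; apply/orP; right.
  rewrite -!big_split; apply: leq_sum => g _ /=.
  by apply: bad_edge_cone => //; rewrite /h ?xl ?zl.
have allB x z : proper x -> rk z = a -> x >=< z ->
  ((\sum_(g in @auts _ P) bad_edge (Fg g) (h g) x z) * #|@flags _ P| <=
   #|@auts _ P| * u (rk x))%N.
  move=> px za xz; have [xl|xl] := leqP (rk x) l; first exact: lowB.
  have pz : proper z by rewrite /proper; move: px; rewrite /proper; lia.
  have zx : z <= x.
    by case/orP: xz => // /(rank_le hrk); lia.
  have [dx rd] : d x <= x /\ rk (d x) = a.
    rewrite /d; case: pickP => [y /andP[? /eqP ?]//|none] /=.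
    have [|y [_ yx ry]] := rank_between hrk (le0x x) (k := a).
      by rewrite hrk.1; lia.
    by have := none y; rewrite yx ry eqxx.
  have pd : proper (d x) by rewrite /proper rd -za.
  (* By submodularity the join of [d x] and [z] has rank at most [2 * a <= b], so an element of rank
     [b] fits between it and [x]. *)
  have [||w [jw wx rw]] := @rank_between _ _ _ hrk (d x `|` z) x b.
  - by rewrite leUx dx.
  - by have := rk_submod (d x) z; move: xl ab bl; rewrite rd za; clear; lia.
  have [dw zw] : d x <= w /\ z <= w by split; apply: le_trans jw; rewrite ?leUl ?leUr.
  have pw : proper w by rewrite /proper rw; move: a0 ab bl ln; clear; lia.
  have cmp := le_comparable.
  have xw : x >=< w by rewrite comparable_sym cmp.
  have xd : x >=< d x by rewrite comparable_sym cmp.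
  have t1 := sum_bad_triangle px pd pw xd (cmp _ _ _ _ dw) xw.
  have t2 := sum_bad_triangle px pz pw xz (cmp _ _ _ _ zw) xw.
  have wl : (rk w <= l)%N by rewrite rw.
  have wd : w >=< d x by rewrite comparable_sym cmp.
  have wz : w >=< z by rewrite comparable_sym cmp.
  have b1 := lowB _ _ pw wl rd wd; have b2 := lowB _ _ pw wl za wz.
  rewrite rw in t1 t2 b1 b2; rewrite za in t2; rewrite rd in t1.
  have xn : (l < rk x <= n)%N by move: px; rewrite /proper xl => /andP[].
  apply: leq_trans (leq_mul (leqnn _) (hhigh _ xn)).
  apply: (@leq_trans ((\sum_(g in @auts _ P) bad_triangle (Fg g) x (d x) w +
     \sum_(g in @auts _ P) bad_triangle (Fg g) x z w +
     \sum_(g in @auts _ P) bad_edge (Fg g) (h g) w (d x) +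
     \sum_(g in @auts _ P) bad_edge (Fg g) (h g) w z) * #|@flags _ P|)); last first.
    rewrite !mulnDl t1 t2 mulnDr !mulnA -!(mulnC 2%N) -!mulnA.
    by move: b1 b2; clear; lia.
  rewrite leq_mul2r; apply/orP; right.
  rewrite -!big_split; apply: leq_sum => g _ /=.
  by apply: bad_edge_descent => //; rewrite /h leqNgt xl /= rd al.
exists h => x y px py xy.
(* A triangle with an element of rank [a] leaves two edges of the kind just bounded. *)
have [|z [za xz yz]] := chain_has_rank hrk hn (a := a) _ px py xy; first lia.
have pz : proper z by rewrite /proper za; lia.
have t := sum_bad_triangle px py pz xy yz xz.
have b1 := allB _ _ px za xz; have b2 := allB _ _ py za yz.
rewrite za in t; apply: (@leq_trans ((\sum_(g in @auts _ P) bad_triangle (Fg g) x y z +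
     \sum_(g in @auts _ P) bad_edge (Fg g) (h g) x z +
     \sum_(g in @auts _ P) bad_edge (Fg g) (h g) y z) * #|@flags _ P|)).
  rewrite leq_mul2r; apply/orP; right.
  rewrite -!big_split; apply: leq_sum => g _ /=; exact: bad_edge_triangle.
by rewrite !mulnDl t !mulnDr; move: b1 b2; clear; lia.
Qed.

(** First-moment method: each [h g], pulled back by [g], is a candidate for [F] itself, and some
    candidate costs no more than the mean over [g]. *)
Lemma exists_averaged_section (h : {perm P} -> P -> G) (beta : nat -> nat -> nat) :
  (forall x y, proper x -> proper y -> x >=< y ->
    ((\sum_(g in @auts _ P) bad_edge (Fg g) (h g) x y) * #|@flags _ P| <=
     #|@auts _ P| * beta (rk x) (rk y))%N) ->
  exists H : P -> G,
    (\sum_(A in @flags _ P) \sum_(x in A) \sum_(y in A) bad_edge F H x y <=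
     \sum_(1 <= i < n.+1) \sum_(1 <= j < n.+1) beta i j)%N.
Proof.
move=> hb; set S := (\sum_(1 <= i < n.+1) _)%N.
pose H g x := h g (g^-1%g x).
pose D K := (\sum_(A in @flags _ P) \sum_(x in A) \sum_(y in A) bad_edge F K x y)%N.
have idA : 1%g \in @auts _ P by apply/autP => x y; rewrite !perm1.
have M0 : (0 < #|@flags _ P|)%N.
  have X0 : finset.set0 \in order_complex P.
    by apply/(chainP hrk hn); split=> [x|x y]; rewrite inE.
  have [A AF _] := face_extends X0.
  by apply/card_gt0P; exists A.
(* Since [g] permutes the flags, [H g] costs against [F] what [h g] costs against the translate of
   [F]. *)
have DE g : g \in @auts _ P ->
    D (H g) = (\sum_(A in @flags _ P) \sum_(x in A) \sum_(y in A)
                 bad_edge (Fg g) (h g) x y)%N.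
  move=> ga; rewrite /D.
  have gi : injective (fun A : {set P} => (g @: A)%SET) by apply: imset_inj; exact: perm_inj.
  rewrite (reindex_inj gi) /=; apply: eq_big => [A|A _].
    apply/idP/idP => [gA|]; last exact: (automorphism_flag hrk hn ga).
    have g'a : (g^-1)%g \in @auts _ P.
      by apply/autP => x y; rewrite -[LHS](elimT (autP _) ga) !permKV.
    have := automorphism_flag hrk hn g'a gA; rewrite -imset_comp.
    suff -> : [set ((g^-1)%g \o g) x | x in A]%SET = A by [].
    by rewrite -[RHS]imset_id; apply: eq_imset => x /=; rewrite permK.
  rewrite big_imset /=; last by move=> x y _ _; exact: perm_inj.
  apply: eq_bigr => x _; rewrite big_imset /=; last by move=> y z _ _; exact: perm_inj.
  by apply: eq_bigr => y _; rewrite /bad_edge /H !permK.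
have tot : (\sum_(g in @auts _ P) D (H g) <= #|@auts _ P| * S)%N.
  rewrite -(leq_pmul2r M0) (eq_bigr _ DE) exchange_big /=.
  have -> : (#|@auts _ P| * S * #|@flags _ P| = \sum_(A in @flags _ P) #|@auts _ P| * S)%N.
    by rewrite sum_nat_const mulnC.
  rewrite big_distrl /=; apply: leq_sum => A AF; have AX := flag_face AF.
  rewrite exchange_big big_distrl /= (big_flag hrk hn _ _ AF) /S big_distrr /=.
  rewrite big_nat [X in (_ <= X)%N]big_nat; apply: leq_sum => i; rewrite ltnS => hi.
  have [xA rx] := elt_in hrk hn AF hi.
  rewrite exchange_big big_distrl /= (big_flag hrk hn _ _ AF) big_distrr /=.
  rewrite big_nat [X in (_ <= X)%N]big_nat; apply: leq_sum => j; rewrite ltnS => hj.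
  have [yA ry] := elt_in hrk hn AF hj.
  rewrite -[in X in (_ <= X)%N]rx -[in X in (_ <= X)%N]ry.
  by apply: hb; rewrite ?/proper ?rx ?ry //; exact: face_chain AX xA yA.
have [/existsP[g /andP[ga gD]]|no] :=
  boolP [exists g, (g \in @auts _ P) && (D (H g) <= S)%N]; first by exists (H g).
move: tot; rewrite leqNgt => /negP[]; rewrite -sum_nat_const.
have hlt g : g \in @auts _ P -> (S < D (H g))%N.
  by move=> ga; rewrite ltnNge; apply: contra no => hD; apply/existsP; exists g; rewrite ga.
(* Isolating the identity gives one strict term, hence a strict inequality between the sums. *)
rewrite (bigD1 1%g) //= [X in (_ < X)%N](bigD1 1%g) //= -addSn.
by apply: leq_add; [exact: hlt | apply: leq_sum => g /andP[ga _]; apply/ltnW/hlt].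
Qed.

End Cone.

(** * Averaging over windows of consecutive ranks *)

Section Averaging.
Local Open Scope nat_scope.
Variables (n m : nat) (e : nat -> nat -> nat -> nat).
Hypothesis m0 : 0 < m.

(** For [e] counting bad triangles by rank, this is the number of bad ordered triples over all
    flags. *)
Definition triple_sum : nat :=
  \sum_(1 <= i < n.+1) \sum_(1 <= j < n.+1) \sum_(1 <= k < n.+1) e i j k.

Lemma sum_window (p : nat) (f : nat -> nat) : 0 < p -> p + m <= n.+1 ->
  \sum_(p <= i < p + m) f i <= \sum_(1 <= i < n.+1) f i.
Proof.
move=> p0 pm; rewrite (@big_cat_nat _ _ _ p 1) //=; last by lia.
rewrite [X in _ <= _ + X](@big_cat_nat _ _ _ (p + m)) ?leq_addr //=.
by rewrite addnCA leq_addr.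
Qed.

Lemma sum_window_le (p : nat) (f g : nat -> nat) : 0 < p -> p + m <= n.+1 ->
  (forall i, f i <= g i) -> \sum_(p <= i < p + m) f i <= \sum_(1 <= i < n.+1) g i.
Proof.
by move=> p0 pm fg; apply: leq_trans (sum_window g p0 pm); apply: leq_sum => i _.
Qed.

Lemma sum_window_const (p c : nat) : \sum_(p <= i < p + m) c = m * c.
Proof. by rewrite sum_nat_const_nat addKn. Qed.

Lemma window_pigeonhole (p : nat) (f : nat -> nat) (S : nat) :
  \sum_(p <= i < p + m) f i <= S -> exists2 i, p <= i < p + m & m * f i <= S.
Proof.
move=> hS; have [/hasP[i]|no] := boolP (has (fun i => m * f i <= S) (index_iota p (p + m))).
  by rewrite mem_index_iota => hi h; exists i.
have hlt i : p <= i < p + m -> S.+1 <= m * f i.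
  move=> hi; rewrite ltnNge; apply: contra no => h; apply/hasP; exists i => //.
  by rewrite mem_index_iota.
have : m * S.+1 <= m * S.
  apply: leq_trans (leq_mul (leqnn m) hS); rewrite -(sum_window_const p) big_distrr /=.
  by rewrite big_nat [X in _ <= X]big_nat; apply: leq_sum => i; exact: hlt.
by rewrite leq_pmul2l // ltnn.
Qed.

Lemma leq_triple_sum (i j k : nat) :
  0 < i <= n -> 0 < j <= n -> 0 < k <= n -> e i j k <= triple_sum.
Proof.
have one f t : 0 < t <= n -> f t <= \sum_(1 <= i < n.+1) f i.
  by move=> ht; rewrite (bigD1_seq t) ?iota_uniq ?mem_index_iota //= leq_addr.
move=> hi hj hk; apply: leq_trans (one (fun k => e i j k) _ hk) _.
apply: leq_trans (one (fun j => \sum_(1 <= k < n.+1) e i j k) _ hj) _.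
exact: (one (fun i => \sum_(1 <= j < n.+1) \sum_(1 <= k < n.+1) e i j k)).
Qed.

Lemma sum_windows3 (p q r : nat) : 0 < p -> p + m <= n.+1 -> 0 < q -> q + m <= n.+1 ->
  0 < r -> r + m <= n.+1 ->
  \sum_(p <= i < p + m) \sum_(q <= j < q + m) \sum_(r <= k < r + m) e i j k
    <= triple_sum.
Proof.
move=> p0 pn q0 qn r0 rn; apply: sum_window_le => // i; apply: sum_window_le => // j.
exact: sum_window.
Qed.

Lemma sum_windows2 (q r : nat) : 0 < q -> q + m <= n.+1 -> 0 < r -> r + m <= n.+1 ->
  \sum_(q <= j < q + m) \sum_(r <= k < r + m) \sum_(1 <= i < n.+1) e i j k
    <= triple_sum.
Proof.
move=> q0 qn r0 rn; rewrite /triple_sum [X in _ <= X]exchange_big /=.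
apply: sum_window_le => // j; rewrite [X in _ <= X]exchange_big /=; exact: sum_window.
Qed.

Lemma sum_windows1 (r : nat) : 0 < r -> r + m <= n.+1 ->
  \sum_(r <= k < r + m) \sum_(1 <= i < n.+1) \sum_(1 <= j < n.+1) e i j k
    <= triple_sum.
Proof.
move=> r0 rn; rewrite [X in X <= _]exchange_big /=; apply: leq_sum => i _.
rewrite [X in X <= _]exchange_big /=; apply: leq_sum => j _; exact: sum_window.
Qed.

Section Windows4.
Variables (pa pb pk ps : nat).

Let S4 (f : nat -> nat -> nat -> nat -> nat) :=
  \sum_(pa <= a < pa + m) \sum_(pb <= b < pb + m)
    \sum_(pk <= k < pk + m) \sum_(ps <= s < ps + m) f a b k s.

Let S4D f g : S4 (fun a b k s => f a b k s + g a b k s) = S4 f + S4 g.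
Proof.
rewrite /S4 -big_split; apply: eq_bigr => a _; rewrite -big_split; apply: eq_bigr => b _.
by rewrite -big_split; apply: eq_bigr => k _; rewrite -big_split.
Qed.

Let S4Z c f : S4 (fun a b k s => c * f a b k s) = c * S4 f.
Proof.
rewrite /S4 big_distrr; apply: eq_bigr => a _; rewrite big_distrr; apply: eq_bigr => b _.
by rewrite big_distrr; apply: eq_bigr => k _; rewrite big_distrr.
Qed.

(* Bounds the sum over all ranks i, j of the cost [e i j a + u i + u j] of an edge, for
   the cone with ranks a, b, k, s; 9 = 3 + 2 * 3 collects the terms [e a k s]. *)
Definition cone_cost (a b k s : nat) : nat :=
  \sum_(1 <= i < n.+1) \sum_(1 <= j < n.+1) e i j a +
  (2 * n) * (\sum_(1 <= i < n.+1) e i k s + \sum_(1 <= i < n.+1) e i a s +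
             2 * (\sum_(1 <= i < n.+1) e i a b) +
             n * (9 * e a k s + 2 * e b k s + 2 * e b a s)).

(** A term of the cost involving t of the ranks a, b, k, s sums over the windows to at most
    [m ^ (4 - t) * triple_sum]. The total coefficients are 1 for t = 1, [2 * n * 4] for t = 2 and
    [2 * n * n * 13] for t = 3. *)
Lemma exists_cheap_cone : 0 < pa -> pa + m <= n.+1 -> 0 < pb -> pb + m <= n.+1 ->
  0 < pk -> pk + m <= n.+1 -> 0 < ps -> ps + m <= n.+1 ->
  exists a b k s, [/\ pa <= a < pa + m, pb <= b < pb + m, pk <= k < pk + m,
    ps <= s < ps + m &
    m ^ 4 * cone_cost a b k s <= (m ^ 3 + 8 * n * m ^ 2 + 26 * n ^ 2 * m) * triple_sum].
Proof.
move=> a0 an b0 bn k0 kn s0 sn.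
have cst p c : \sum_(p <= i < p + m) c = m * c := sum_window_const p c.
have t1 : S4 (fun a _ _ _ => \sum_(1 <= i < n.+1) \sum_(1 <= j < n.+1) e i j a)
    <= m ^ 3 * triple_sum.
  rewrite /S4; under eq_bigr do rewrite !cst; rewrite -!big_distrr /=.
  by rewrite !expnS expn0 muln1 -!mulnA; do 3 rewrite leq_pmul2l //; exact: sum_windows1.
have t2 : S4 (fun _ _ k s => \sum_(1 <= i < n.+1) e i k s) <= m ^ 2 * triple_sum.
  rewrite /S4 !cst mulnA leq_mul2l; apply/orP; right; exact: sum_windows2.
have t3 : S4 (fun a _ _ s => \sum_(1 <= i < n.+1) e i a s) <= m ^ 2 * triple_sum.
  rewrite /S4; under eq_bigr do rewrite !cst; rewrite -!big_distrr /= mulnA.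
  by rewrite leq_mul2l; apply/orP; right; exact: sum_windows2.
have t4 : S4 (fun a b _ _ => \sum_(1 <= i < n.+1) e i a b) <= m ^ 2 * triple_sum.
  rewrite /S4; under eq_bigr do (under eq_bigr do rewrite !cst; rewrite -!big_distrr /=).
  rewrite -!big_distrr /= mulnA.
  by rewrite leq_mul2l; apply/orP; right; exact: sum_windows2.
have t5 : S4 (fun a _ k s => e a k s) <= m * triple_sum.
  rewrite /S4; under eq_bigr do rewrite !cst; rewrite -!big_distrr /=.
  by rewrite leq_mul2l; apply/orP; right; exact: sum_windows3.
have t6 : S4 (fun _ b k s => e b k s) <= m * triple_sum.
  by rewrite /S4 cst leq_mul2l; apply/orP; right; exact: sum_windows3.
have t7 : S4 (fun a b _ s => e b a s) <= m * triple_sum.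
  rewrite /S4; under eq_bigr do (under eq_bigr do rewrite !cst; rewrite -!big_distrr /=).
  rewrite -!big_distrr /= exchange_big /=.
  by rewrite leq_mul2l; apply/orP; right; exact: sum_windows3.
have tot : S4 cone_cost <= (m ^ 3 + 8 * n * m ^ 2 + 26 * n ^ 2 * m) * triple_sum.
  rewrite /cone_cost !(S4D, S4Z).
  apply: (@leq_trans (m ^ 3 * triple_sum + (2 * n) * (m ^ 2 * triple_sum +
    m ^ 2 * triple_sum + 2 * (m ^ 2 * triple_sum) +
    n * (9 * (m * triple_sum) + 2 * (m * triple_sum) + 2 * (m * triple_sum))))).
    by do ?[apply: leq_add | apply: leq_mul].
  by rewrite eq_leq //; lia.
(* The four ranks are fixed one at a time, each keeping the cost within the mean over its window. *)
have [a ha] := window_pigeonhole tot; rewrite big_distrr /= => {}tot.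
have [b hb] := window_pigeonhole tot; rewrite mulnA big_distrr /= => {}tot.
have [k hk] := window_pigeonhole tot; rewrite mulnA big_distrr /= => {}tot.
have [s hs {}tot] := window_pigeonhole tot.
exists a, b, k, s; split=> //; apply: leq_trans tot.
by rewrite eq_leq // !expnS expn0 muln1 !mulnA.
Qed.

End Windows4.
End Averaging.

(** * Choice of the cone, in low and in high rank *)

Section GoodSection.
Import Order.TTheory.
Local Open Scope order_scope.
Context {disp : Order.disp_t} {P : finTBLatticeType disp} {rk : P -> nat}.
Hypothesis hrk : rank_function rk.
Hypothesis rk_submod :
  forall x y : P, (rk (x `|` y) + rk (x `&` y) <= rk x + rk y)%N.
Variable n : nat.
Hypothesis hn : rk \top = n.+1.
Hypothesis n3 : (3 <= n)%N.
Hypothesis hhom : homogeneous P.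
Context {G : groupType} (F : P -> P -> G).
Hypothesis Fsym : forall x y, F y x = ((F x y)^-1)%g.

Let e := tricount (rk := rk) (bad_triangle F).
Let T := triple_sum n e.
Let D H := (\sum_(A in @flags _ P) \sum_(x in A) \sum_(y in A) bad_edge F H x y)%N.

Let sum_beta (a : nat) (u : nat -> nat) :
  (\sum_(1 <= i < n.+1) \sum_(1 <= j < n.+1) (e i j a + u i + u j) =
   \sum_(1 <= i < n.+1) \sum_(1 <= j < n.+1) e i j a +
   2 * n * \sum_(1 <= i < n.+1) u i)%N.
Proof.
under eq_bigr do rewrite big_split big_split /= sum_nat_const_nat subn1 /=.
by rewrite big_split big_split /= sum_nat_const_nat subn1 /= -big_distrr /=; lia.
Qed.

Let rank_join (x y : P) : (rk (x `|` y) <= rk x + rk y)%N.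
Proof. by apply: leq_trans (rk_submod x y); rewrite leq_addr. Qed.

Let exists_rank (i : nat) : (i <= n)%N -> exists c : P, rk c = i.
Proof.
move=> hi; have [|c [_ _ rc]] := rank_between hrk (le0x (\top : P)) (k := i).
  by rewrite hrk.1 hn /= (leq_trans hi).
by exists c.
Qed.

(* Here the cone is [p x = x `|` c] with c an atom; the ranks of its triangles are
   not controlled, and each [e i j k] is bounded by the total [T]. *)
Lemma good_section_low_rank : (n <= 22)%N ->
  exists H : P -> G, ((n - 2) * D H <= 300 * 400 * T)%N.
Proof.
move=> n22; have [|c rc] := @exists_rank 1; first by rewrite (leq_trans _ n3).
(* A pentagon has five triangles; rank [n], the only one above [l = n.-1], costs two triangles and
   two low edges, 2 + 2 * 5 = 12. *)
pose u i := if (i < n)%N then (5 * T)%N else (12 * T)%N.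
have eT i j k : (0 < i <= n)%N -> (0 < j <= n)%N -> (0 < k <= n)%N -> (e i j k <= T)%N.
  exact: leq_triple_sum.
have [||||||x z px xl rz xz|j hj|h hh] := @cone_bound _ P rk hrk rk_submod n hn hhom _ F
  Fsym 1 2 n.-1 c (fun x => x `|` c) u => //.
- by move: n3; clear; lia.
- exact: leq_pred.
- by rewrite rc; move: n3; clear; lia.
- by move=> x _ _; rewrite leUl leUr.
- have rxc := rank_join x c; have rzc := rank_join z c.
  (* As [x] and [z] are comparable, the larger of the two joins with [c] is an apex; joining the
     atom [c] raises the rank by at most 1. *)
  have [w [xw zw wn]] : exists w, [/\ x `|` c <= w, z `|` c <= w & (rk w <= n)%N].
    case/orP: xz => [xz|zx].
      exists (z `|` c); split; [exact: leU2|exact: lexx|].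
      by move: rzc; rewrite rz rc; move: n3; clear; lia.
    exists (x `|` c); split; [exact: lexx|exact: leU2|].
    by move: rxc xl; rewrite rc; move: n3; clear; lia.
  exists w; split=> //.
  have xc : (0 < rk (x `|` c) <= n)%N.
    by have := rank_le hrk (leUr c x); have := rank_le hrk xw; move: rc wn; clear; lia.
  have zc : (0 < rk (z `|` c) <= n)%N.
    by have := rank_le hrk (leUr c z); have := rank_le hrk zw; move: rc wn; clear; lia.
  have wr : (0 < rk w <= n)%N.
    by have := rank_le hrk xw; move: wn xc; clear; lia.
  have -> : u (rk x) = (5 * T)%N.
    by rewrite /u; case: ifP => //; move: xl n3; clear; lia.
  have r1 : (0 < 1 <= n)%N by move: n3; clear; lia.
  have := eT _ _ _ px xc wr; have := eT _ _ _ px r1 wr; have := eT _ _ _ r1 zc wr.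
  have := eT _ _ _ r1 xc wr; have := eT _ _ _ r1 zc wr; rewrite rc -/e; clear; lia.
- have hj' : (0 < j <= n)%N by move: hj n3; clear; lia.
  have r1 : (0 < 1 <= n)%N by move: n3; clear; lia.
  have r2 : (0 < 2 <= n)%N by move: n3; clear; lia.
  have -> : u j = (12 * T)%N by rewrite /u; case: ifP => //; move: hj; clear; lia.
  have -> : u 2 = (5 * T)%N by rewrite /u; case: ifP => //; move: n3; clear; lia.
  by have := eT _ _ _ hj' r1 r2; rewrite -/e; clear; lia.
have [H hH] := @exists_averaged_section _ P rk hrk n hn G F h
  (fun i j => e i j 1 + u i + u j)%N hh; exists H.
apply: leq_trans (leq_mul (leqnn _) hH) _; rewrite sum_beta.
have s1 : (\sum_(1 <= i < n.+1) \sum_(1 <= j < n.+1) e i j 1 <= n * (n * T))%N.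
  rewrite -[X in (_ <= X * _)%N](subn1 n.+1) -sum_nat_const_nat.
  rewrite big_nat [X in (_ <= X)%N]big_nat; apply: leq_sum => i hi.
  rewrite -[X in (_ <= X * _)%N](subn1 n.+1) -sum_nat_const_nat.
  rewrite big_nat [X in (_ <= X)%N]big_nat; apply: leq_sum => j hj.
  by apply: eT => //; move: n3; clear; lia.
have s2 : (\sum_(1 <= i < n.+1) u i <= (5 * n + 7) * T)%N.
  rewrite big_nat_recr /=; last by move: n3; clear; lia.
  have -> : u n = (12 * T)%N by rewrite /u ltnn.
  have : (\sum_(1 <= i < n) u i <= (n - 1) * (5 * T))%N.
    rewrite -sum_nat_const_nat big_nat [X in (_ <= X)%N]big_nat.
    by apply: leq_sum => i /andP[_ hi]; rewrite /u hi.
  by move: n3; clear; nia.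
apply: (@leq_trans ((n - 2) * (n * (n * T) + 2 * n * ((5 * n + 7) * T)))).
  by rewrite leq_mul // leq_add // leq_mul.
rewrite (_ : (_ * (_ + _) = (n - 2) * (n * n + 2 * n * (5 * n + 7)) * T)%N); last first.
  by clear; lia.
rewrite leq_mul2r; apply/orP; right.
(* The value at [n = 22] is 20 * 5632 = 112640, below 120000. *)
apply: (@leq_trans (20 * (22 * 22 + 2 * 22 * (5 * 22 + 7)))%N); last by clear; lia.
by apply: leq_mul; [move: n22; clear; lia|apply: leq_add; do ?apply: leq_mul; move: n22; clear; lia].
Qed.

(* With windows of length [m = n %/ 11] at 1, 2m, 4m, 10m and [l = 3m], one has
   [l + a <= k], which leaves room for [p x] of rank [k] above x and c, and [2k <= s],
   which leaves room for a common upper bound of [p x] and [p z] of rank [s]. *)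
Lemma good_section_high_rank : (23 <= n)%N ->
  exists H : P -> G, ((n - 2) * D H <= 300 * 400 * T)%N.
Proof.
move=> n23; pose m := (n %/ 11)%N.
have mn : (11 * m <= n)%N by rewrite mulnC leq_trunc_div.
have nm : (n < 11 * m + 11)%N by rewrite addnC -mulnS mulnC ltn_ceil.
have m0 : (0 < m)%N by move: nm n23; clear; lia.
have [||||||||a [b [k [s [ha hb hk hs cost]]]]] :=
  @exists_cheap_cone n m e m0 1 (2 * m) (4 * m) (10 * m);
  try by move: mn m0; clear; lia.
have [|c rc] := @exists_rank a; first by move: ha mn; clear; lia.
(* The base vertex has rank [a], the middle vertices rank [k] and the apex rank [s], so three of the
   five triangles have ranks a, k, s. *)
pose lowu i := (e i k s + e i a s + 3 * e a k s)%N.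
pose u i := if (i <= 3 * m)%N then lowu i else (2 * e i a b + 2 * lowu b)%N.
pose p x : P := odflt \bot [pick y | (x `|` c <= y) && (rk y == k)].
have hp x : (rk x <= 3 * m)%N -> x `|` c <= p x /\ rk (p x) = k.
  move=> xl; rewrite /p; case: pickP => [y /andP[? /eqP ?]//|none] /=.
  have [|y [xy _ ry]] := rank_between hrk (lex1 (x `|` c)) (k := k).
    have := rank_join x c; rewrite rc hn; move: xl ha hk mn; clear; lia.
  by have := none y; rewrite xy ry eqxx.
have [||||||x z px xl rz xz|j hj|h hh] := @cone_bound _ P rk hrk rk_submod n hn hhom _ F
  Fsym a b (3 * m)%N c p u => //.
- by case/andP: ha.
- by move: ha hb; clear; lia.
- by move: hb; clear; lia.
- by move: mn; clear; lia.
- by rewrite rc; move: ha mn; clear; lia.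
- move=> x _ xl; have [xp _] := hp _ xl.
  by split; apply: le_trans xp; rewrite ?leUl ?leUr.
- have zl : (rk z <= 3 * m)%N by rewrite rz; move: ha m0; clear; lia.
  have [xp rpx] := hp _ xl; have [zp rpz] := hp _ zl.
  have [|w [pw _ rw]] := rank_between hrk (lex1 (p x `|` p z)) (k := s).
    by have := rank_join (p x) (p z); rewrite rpx rpz hn; move: hk hs mn; clear; lia.
  exists w; split.
  + by apply: le_trans pw; rewrite leUl.
  + by apply: le_trans pw; rewrite leUr.
  + by rewrite rw; move: hs mn; clear; lia.
  + by rewrite rpx rpz rw rc /u xl /lowu -/e; clear; lia.
- have -> : u b = lowu b by rewrite /u; case: ifP => //; move: hb; clear; lia.
  by rewrite /u [X in if X then _ else _]leqNgt; case/andP: hj => ->.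
have [H hH] := @exists_averaged_section _ P rk hrk n hn G F h
  (fun i j => e i j a + u i + u j)%N hh; exists H.
rewrite sum_beta in hH.
have hD : (D H <= cone_cost n e a b k s)%N.
  apply: leq_trans hH _; rewrite /cone_cost leq_add2l leq_mul2l; apply/orP; right.
  (* The sum of the low and high formulas bounds [u] at every rank. *)
  apply: (@leq_trans (\sum_(1 <= i < n.+1) (e i k s + e i a s + 2 * e i a b +
      (9 * e a k s + 2 * e b k s + 2 * e b a s)))).
    by apply: leq_sum => i _; rewrite /u /lowu; case: ifP => _; clear; lia.
  by rewrite 3!big_split /= sum_nat_const_nat subn1 -big_distrr.
have m4 : (0 < m ^ 4)%N by rewrite expn_gt0 m0.
rewrite -(leq_pmul2l m4) mulnCA.
apply: leq_trans (leq_mul (leqnn (n - 2)) (leq_trans (leq_mul (leqnn _) hD) cost)) _.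
rewrite mulnA [X in (_ <= X)%N]mulnA leq_mul2r; apply/orP; right.
(* From [m >= 2], so that [11 * m + 10 <= 16 * m]. *)
have n16 : (n <= 16 * m)%N by move: nm n23; clear; lia.
apply: (@leq_trans ((16 * m) * (m ^ 3 + 8 * (16 * m) * m ^ 2 + 26 * (16 * m) ^ 2 * m))).
  apply: leq_mul; first by move: n16; clear; lia.
  by rewrite !leq_add // !leq_mul // leq_exp2r.
(* The coefficient of [m ^ 4] is 16 * (1 + 128 + 6656) = 108560, below 120000. *)
by rewrite !expnS !expn0 !muln1; clear; lia.
Qed.

(** The factor [n - 2] is the ratio of the weights of an ordered edge and an ordered triangle of a
    flag; it turns this count into a bound on probabilities. *)
Lemma good_section : exists H : P -> G, ((n - 2) * D H <= 300 * 400 * T)%N.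
Proof.
by have [/good_section_low_rank|/good_section_high_rank] := leqP n 22.
Qed.

End GoodSection.

(** * From counts in flags to distances and weights of cochains *)

Section CoboundaryDistance.
Import Order.TTheory GRing.Theory Num.Theory.
Local Open Scope ring_scope.
Context {R : realType} {disp : Order.disp_t} {P : finTBLatticeType disp} {rk : P -> nat}.
Hypothesis hrk : rank_function rk.
Variable n : nat.
Hypothesis hn : rk \top%O = n.+1.
Hypothesis n3 : (3 <= n)%N.
Context {G : groupType}.
Implicit Types (f : P -> P -> G) (H : P -> G).

Local Notation X := (order_complex P).

(** The probability of a given flag with a given ordered [k]-tuple in it, all flags having [n]
    elements. *)
Let weight (k : nat) : R := #|@flags _ P|%:R^-1 * (n ^_ k)%:R^-1.

Let massE (t : seq P) : mass X R t =
  weight (size t) * (\sum_(s in @flags _ P) (uniq t && all (fun x => x \in s) t))%:R.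
Proof.
rewrite /mass -/flags natr_sum mulr_sumr big_mkcondr; apply: eq_bigr => s sF.
by rewrite (card_flag hrk hn sF); case: ifP; rewrite ?mulr1 ?mulr0.
Qed.

Lemma weight_gt0 (k : nat) : (k <= n)%N -> 0 < weight k.
Proof.
move=> kn; rewrite mulr_gt0 // invr_gt0 ltr0n ?ffact_gt0 //.
have X0 : finset.set0 \in order_complex P.
  by apply/(chainP hrk hn); split=> [x|x y]; rewrite inE.
by have [A AF _] := face_extends X0; apply/card_gt0P; exists A.
Qed.

Lemma dist1_count f g : dist1 X R f g = weight 2 *
  (\sum_(s in @flags _ P) \sum_v \sum_u
     [&& f v u != g v u, uniq [:: v; u], v \in s & u \in s])%:R.
Proof.
rewrite exchange_big natr_sum mulr_sumr; apply: eq_bigr => v _ /=.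
rewrite exchange_big natr_sum mulr_sumr big_mkcond /=; apply: eq_bigr => u _.
case: ifP => fg; last by rewrite big1 ?mulr0.
by rewrite massE /=; congr (_ * _%:R); apply: eq_bigr => s _; rewrite !andbT.
Qed.

Lemma wt2_count (f : P -> P -> P -> G) : wt2 X R f = weight 3 *
  (\sum_(s in @flags _ P) \sum_v \sum_u \sum_w
     [&& f v u w != 1%g, uniq [:: v; u; w], v \in s, u \in s & w \in s])%:R.
Proof.
rewrite exchange_big natr_sum mulr_sumr; apply: eq_bigr => v _ /=.
rewrite exchange_big natr_sum mulr_sumr; apply: eq_bigr => u _ /=.
rewrite exchange_big natr_sum mulr_sumr big_mkcond /=; apply: eq_bigr => w _.
case: ifP => fg; last by rewrite big1 ?mulr0.
by rewrite massE /=; congr (_ * _%:R); apply: eq_bigr => s _; rewrite !andbT.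
Qed.

Lemma face_edge (s : {set P}) (v u : P) : s \in X ->
  v \in s -> u \in s -> v != u -> edge X v u.
Proof.
move=> sX vs us vu; rewrite /edge /= mem_seq1 vu /=; apply/(chainP hrk hn).
have sub x : x \in [set v; u]%SET -> x \in s by rewrite !inE => /orP[] /eqP ->.
by split=> [x /sub xs|x y /sub xs /sub ys]; [exact: (face_rank hrk hn sX xs) | exact: face_chain sX xs ys].
Qed.

Lemma edge_sym (v u : P) : edge X v u = edge X u v.
Proof. by rewrite /edge finset.setUC /= !mem_seq1 eq_sym. Qed.

(** The edge lies in some flag and adds at least 1 to an integer count: nonzero distances are at
    least [weight 2]. *)
Lemma dist1_edge_ge f g (v u : P) : edge X v u -> f v u != g v u ->
  weight 2 <= dist1 X R f g.
Proof.
move=> /andP[]; rewrite /= mem_seq1 andbT => vu vuX fg; rewrite dist1_count ler_peMr ?(ltW (weight_gt0 _)) ?(ltnW n3) //.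
have [A AF /fintype.subsetP sA] := face_extends vuX.
rewrite ler1n (bigD1 A) //= (bigD1 v) //= (bigD1 u) //= fg.
by rewrite (sA v) ?(sA u) ?inE ?eqxx ?orbT //= vu.
Qed.

Hypothesis rk_submod :
  forall x y : P, (rk (x `|` y)%O + rk (x `&` y)%O <= rk x + rk y)%N.
Hypothesis hhom : homogeneous P.

Lemma coboundary_distance f : C1 X f ->
  exists H : P -> G, dist1 X R f (delta0 H) <= 198288%:R * wt2 X R (delta1 f).
Proof.
move=> fC.
(* The value 1 off the edges makes [F] antisymmetric on all pairs and trivial on the diagonal. *)
pose F v u : G := if edge X v u then f v u else 1%g.
have Fsym v u : F u v = (F v u)^-1%g.
  by rewrite /F edge_sym; case: ifP => [vu|_]; rewrite ?invg1 // fC // edge_sym.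
have Fdiag v : F v v = 1%g by rewrite /F /edge /= inE eqxx.
have [H hH] := good_section hrk rk_submod hn n3 hhom Fsym.
exists H; rewrite dist1_count wt2_count.
set D2 := (\sum_(s in _) _)%N; set D3 := (\sum_(s in _) _)%N.
have le2 : (D2 <= \sum_(A in @flags _ P) \sum_(x in A) \sum_(y in A) bad_edge F H x y)%N.
  apply: leq_sum => A AF; have AX := flag_face AF.
  rewrite [X in (_ <= X)%N]big_mkcond; apply: leq_sum => x _ /=.
  case: ifP => xA; last by rewrite big1 // => y _; rewrite !andbF.
  rewrite [X in (_ <= X)%N]big_mkcond; apply: leq_sum => y _ /=.
  case: ifP => yA; last by rewrite !andbF.
  rewrite inE !andbT; have [|xy] := eqVneq x y; first by rewrite andbF.
  by rewrite /bad_edge /F (face_edge AX) // andbT.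
(* A triple with a repeated vertex is good for [F], so the bad triples in flags are violated
   triangles of [f]. *)
have le3 : (triple_sum n (tricount (rk := rk) (bad_triangle F)) <= D3)%N.
  have -> : triple_sum n (tricount (rk := rk) (bad_triangle F)) =
      (\sum_(A in @flags _ P) \sum_(x in A) \sum_(y in A) \sum_(z in A)
         bad_triangle F x y z)%N.
    rewrite /triple_sum /tricount.
    under eq_bigr do (under eq_bigr do rewrite exchange_big /=; rewrite exchange_big /=).
    rewrite exchange_big /=; apply: eq_bigr => A AF.
    rewrite (big_flag hrk hn _ _ AF); apply: eq_bigr => i _.
    rewrite (big_flag hrk hn _ _ AF); apply: eq_bigr => j _.
    by rewrite (big_flag hrk hn _ _ AF).
  apply: leq_sum => A AF; have AX := flag_face AF.
  rewrite big_mkcond; apply: leq_sum => x _ /=; case: ifP => // xA.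
  rewrite big_mkcond; apply: leq_sum => y _ /=; case: ifP => // yA.
  rewrite big_mkcond; apply: leq_sum => z _ /=; case: ifP => // zA.
  rewrite !inE !andbT /bad_triangle.
  have [->|xy] := eqVneq x y; first by rewrite Fdiag mul1g (Fsym y z) mulgV eqxx.
  have [->|xz] := eqVneq x z; first by rewrite Fdiag mulg1 (Fsym z y) mulgV eqxx.
  have [->|yz] := eqVneq y z; first by rewrite Fdiag mulg1 (Fsym x z) mulgV eqxx.
  by rewrite /F !(face_edge AX) // 1?eq_sym // andbT.
have hnat : ((n - 2) * D2 <= 198288 * D3)%N.
  apply: leq_trans (leq_mul (leqnn _) le2) _; apply: leq_trans hH _.
  by apply: leq_mul; [vm_compute | ].
(* An ordered pair in a flag extends to an ordered triple in [n - 2] ways. *)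
have w23 : weight 2 = (n - 2)%:R * weight 3.
  rewrite /weight [(n ^_ 3)%N]ffactnSr natrM invfM mulrCA; congr (_ * _).
  rewrite mulrCA divff ?mulr1 // pnatr_eq0 -lt0n; move: n3; clear; lia.
rewrite w23 -mulrA mulrCA [X in _ <= X]mulrCA ler_pM2l ?weight_gt0 //.
by rewrite -!natrM ler_nat.
Qed.

Lemma exact_coboundary f H : dist1 X R f (delta0 H) < weight 2 -> B1 X f.
Proof.
move=> small; exists H => v u vu; apply/eqP; apply: contraLR small => fg.
by rewrite -leNgt (dist1_edge_ge vu).
Qed.

Lemma wt2_cocycle f : Z1 X f -> wt2 X R (delta1 f) = 0.
Proof.
case=> _ fZ; rewrite wt2_count big1 ?mulr0 // => s sF; have sX := flag_face sF.
apply: big1 => v _; apply: big1 => u _; apply: big1 => w _.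
case: and5P => // -[/eqP ne uq vs us ws]; case: ne; apply: fZ; rewrite /triangle uq /=.
have sub x : x \in [set v; u; w]%SET -> x \in s by rewrite !inE => /orP[/orP[]|] /eqP ->.
by apply/(chainP hrk hn); split=> [x /sub xs|x y /sub xs /sub ys];
  [exact: (face_rank hrk hn sX xs) | exact: face_chain sX xs ys].
Qed.

Lemma coboundary_cocycle f : B1 X f -> Z1 X f.
Proof.
case=> H fH; split=> [v u vu|v u w /andP[]].
  by rewrite !fH // 1?edge_sym // /delta0 invMg invgK.
rewrite /= !(in_cons, in_nil) negb_or !orbF !andbT => /andP[/andP[vu vw] uw] sX.
have eg x y : x \in [set v; u; w]%SET -> y \in [set v; u; w]%SET -> x != y -> edge X x y.
  exact: face_edge.
rewrite /delta1 !fH ?eg ?inE ?eqxx ?orbT // 1?eq_sym // /delta0.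
by rewrite !mulgA !mulgKV mulgV.
Qed.

(** The gap between distances survives the infimum, which makes the denominator in [h1] positive. *)
Lemma dist_B1_gt0 f : ~ B1 X f -> weight 2 <= dist_B1 X R f.
Proof.
move=> fB; apply: lb_le_inf => [|_ [g [H gH] <-]].
  by exists (dist1 X R f (delta0 (fun=> 1%g))), (delta0 (fun=> 1%g)) => //; exists (fun=> 1%g).
have [vu|no] := pselect (exists v u, edge X v u /\ f v u != g v u).
  by case: vu => v [u [vu fg]]; exact: dist1_edge_ge vu fg.
case: fB; exists H => v u vu; rewrite -gH //; apply/eqP/negPn/negP => fg.
by apply: no; exists v, u.
Qed.

Lemma dist_B1_le f H : dist_B1 X R f <= dist1 X R f (delta0 H).
Proof.
apply: ge_inf; last by exists (delta0 H) => //; exists H.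
exists 0 => _ [g _ <-]; rewrite dist1_count mulr_ge0 ?ler0n //.
by rewrite ltW // weight_gt0 // ltnW.
Qed.

End CoboundaryDistance.

(** * Vanishing of cohomology and the expansion bound *)

Lemma triangle_rank (disp : Order.disp_t) (P : finTBLatticeType disp) (rk : P -> nat)
    (n : nat) : rank_function rk -> rk \top%O = n.+1 ->
  has_triangle (order_complex P) -> (3 <= n)%N.
Proof.
move=> hrk hn [v [u [w /andP[uq /face_extends[A AF sA]]]]].
(* The triangle sits inside a flag, which has [n] elements. *)
rewrite -(card_flag hrk hn AF); apply: leq_trans (subset_leq_card sA).
move: uq; rewrite /= !(in_cons, in_nil) negb_or !orbF !andbT => /andP[/andP[vu vw] uw].
rewrite finset.setUC cardsU1 !inE cards2 vu.
by rewrite negb_or ![w == _]eq_sym vw uw.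
Qed.

Theorem theoremA1 (R : realType) (d : nat) (hd : (3 <= d)%N)
    (disp : Order.disp_t) (P : finTBLatticeType disp) (rk : P -> nat)
    (hgeom : geometric_lattice rk) (hrank : rk (\top)%O = d)
    (hhom : homogeneous P)
    (htri : has_triangle (order_complex P))
    (G : groupType) :
  @Z1 P (order_complex P) G = @B1 P (order_complex P) G /\
  ((198288%:R^-1 : R)%:E <= h1 (order_complex P) R G)%E.
Proof.
Import Order.TTheory GRing.Theory Num.Theory.
have [hrk hsub _] := hgeom; case: d hd hrank => // n _ hn.
have n3 := triangle_rank hrk hn htri; have n2 := ltnW n3.
have main f := @coboundary_distance R _ P rk hrk n hn n3 G hsub hhom f.
have w0 := @weight_gt0 R _ P rk hrk n hn 2 n2.
split.
  apply/seteqP; split=> f; last exact: (coboundary_cocycle hrk hn).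
  (* A cocycle violates no triangle, so some coboundary is at distance 0 from it, hence equal to it
     on edges. *)
  move=> fZ; have [H hH] := main f fZ.1.
  apply: (exact_coboundary hrk hn n3 (H := H)); apply: le_lt_trans hH _.
  by rewrite (wt2_cocycle hrk hn fZ) mulr0.
apply: le_ereal_inf_tmp => _ [f [fC fB] <-]; rewrite lee_fin.
have [H hH] := main f fC.
have dpos := lt_le_trans w0 (dist_B1_gt0 hrk hn n3 fB).
rewrite ler_pdivlMr // mulrC ler_pdivrMr ?ltr0n // mulrC.
exact: le_trans (dist_B1_le hrk hn n3 f H) hH.
Qed.
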